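(* Let $d\geq2$, $m>0$, $1\leq d'\leq d-1$, and let $p$ be the distribution on $\mathbb{Z}^d$ given by $p_{k_1,\dots,k_d}=f_{m,d}(a_1,\dots,a_d)^{-1}\big(1+\sum_{i=1}^d k_i^2/a_i^2\big)^{-\frac{m+d}{2}}$, with $f_{m,d}$ the normalizing constant. Let $p_{k_1,\dots,k_{d'}}=\sum_{(k_{d'+1},\dots,k_d)\in\mathbb{Z}^{d-d'}}p_{k_1,\dots,k_d}$ be its $d'$-variate marginal. Then for every fixed $(k_1,\dots,k_{d'})\in\mathbb{Z}^{d'}$, as $\min_{1\le i\le d}a_i\to\infty$, $$\frac{p_{k_1,\dots,k_{d'}}}{\dfrac{\Gamma(\frac{m+d'}{2})}{\pi^{d'/2}\,\Gamma(\frac m2)\prod_{i=1}^{d'}a_i}\Big(1+\sum_{i=1}^{d'}\dfrac{k_i^2}{a_i^2}\Big)^{-\frac{m+d'}{2}}}\to1,$$ i.e. the marginal is asymptotically the $d'$-variate discrete Tsallis law with the same parameter $m$.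
   Context: $\Gamma$ is the Euler Gamma function; $f_{m,d}(a_1,\dots,a_d)=\sum_{k\in\mathbb{Z}^d}\big(1+\sum_{i=1}^dk_i^2/a_i^2\big)^{-\frac{m+d}{2}}$. *)

(* Defs.v *)
From HB Require Import structures.
From mathcomp Require Import all_boot all_order all_algebra.
From mathcomp Require Import all_classical all_reals all_analysis.
Import Order.TTheory GRing.Theory Num.Theory.
Local Open Scope classical_set_scope.
Local Open Scope ring_scope.

Definition Gamma {R : realType} (s : R) : R :=
  fine (\int[@lebesgue_measure R]_(t in `]0%R, +oo[%classic)
          ((t `^ (s - 1)) * expR (- t))%:E).

Definition tsallis_weight {R : realType} (d : nat) (m : R) (a : nat -> R)
    (k : {ffun 'I_d -> int}) : R :=
  (1 + \sum_(i < d) ((k i)%:~R ^+ 2 / (a (val i)) ^+ 2)) `^ (- ((m + d%:R) / 2)).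

Definition f_md {R : realType} (d : nat) (m : R) (a : nat -> R) : R :=
  fine (\esum_(k in [set: {ffun 'I_d -> int}]) (tsallis_weight d m a k)%:E).

Definition tsallis_p {R : realType} (d : nat) (m : R) (a : nat -> R)
    (k : {ffun 'I_d -> int}) : R :=
  tsallis_weight d m a k / f_md d m a.

(* d'-variate marginal: sum of p over all k in Z^d whose first d' coordinates
   are kp (i.e. sum over (k_{d'+1},...,k_d) in Z^(d-d')). *)
Definition marginal {R : realType} (d d' : nat) (m : R) (a : nat -> R)
    (kp : 'I_d' -> int) : R :=
  fine (\esum_(k in [set k : {ffun 'I_d -> int} |
                forall (i : 'I_d) (j : 'I_d'), val i = val j -> k i = kp j])
          (tsallis_p d m a k)%:E).

Definition tsallis_approx {R : realType} (d' : nat) (m : R) (a : nat -> R)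
    (kp : 'I_d' -> int) : R :=
  Gamma ((m + d'%:R) / 2)
    / (pi `^ (d'%:R / 2) * Gamma (m / 2) * \prod_(j < d') a (val j))
  * (1 + \sum_(j < d') ((kp j)%:~R ^+ 2 / (a (val j)) ^+ 2)) `^ (- ((m + d'%:R) / 2)).

(* Main.v *)
Require Import Defs.
From HB Require Import structures.
From mathcomp Require Import all_boot all_order all_algebra.
From mathcomp Require Import all_classical all_reals all_analysis.
From mathcomp Require Import measurable_realfun.
From mathcomp Require Import ring lra.
Import Order.TTheory GRing.Theory Num.Theory.
Import numFieldNormedType.Exports.
Local Open Scope classical_set_scope.
Local Open Scope ring_scope.

(* Write [c s] for the integral of [(1 + y^2)^-s] over the line. Summing
   [(B + l^2 / a^2)^-s] over the integers [l] and comparing with the integral of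
   this even, unimodal function gives [a * c s * B^-(s - 1/2)] up to an error
   [B^-s], which is at most a fraction [1 / (a * c s)] of it when [1 <= B].
   The result is again a power of the quadratic form in one variable less, so
   summing out the coordinates one at a time multiplies relative errors only:
   each sum over k_{e+1}, ..., k_d is
     [prod_{e < i <= d} a_i c((m + i)/2)] * [(1 + sum_{i <= e} k_i^2/a_i^2)^-((m + e)/2)]
   up to a factor between [(1 - eta)^(d - e)] and its inverse. Finally
   [c s = sqrt pi * Gamma (s - 1/2) / Gamma s], by Tonelli applied to
   [t^(s-1) * exp (- t (1 + y^2))], so that the product of the constants
   telescopes to the normalizing constant of the theorem. *)

(** * Gamma function and Student integral *)

(** Typed on [measurableTypeR R] so that Lebesgue measure can be pushed forward along it. *)
Definition lebesgue_dilation {R : realType} (c : R) :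
  measurableTypeR R -> measurableTypeR R := fun x => c * x.

Lemma measurable_lebesgue_dilation {R : realType} (c : R) :
  measurable_fun setT (lebesgue_dilation c).
Proof. exact: measurable_funM. Qed.

(** By uniqueness of Lebesgue measure: the rescaled pushforward gives each []a, b]] its length. *)
Lemma lebesgue_measure_scale {R : realType} (c : {nonneg R}) (A : set R) :
  0 < c%:num -> measurable A ->
  @lebesgue_measure R A =
  (c%:num%:E * lebesgue_measure (lebesgue_dilation c%:num @^-1` A))%E.
Proof.
move=> c0 mA.
have mc := @measurable_lebesgue_dilation R c%:num.
pose nu : {measure set (measurableTypeR R) -> \bar R} :=
  measure_function_pushforward__canonical__measure_function_Measure
    lebesgue_measure mc.
apply: (@lebesgue_measure_unique _ (mscale c nu)) => //= _ [[a b]] _ <-.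
rewrite /mscale /= /pushforward.
have -> : (lebesgue_dilation c%:num) @^-1` `]a, b] =
    `]a / c%:num, b / c%:num]%classic.
  apply/seteqP; split=> x /=; rewrite !in_itv/= ltr_pdivrMr// ler_pdivlMr//;
    by rewrite mulrC.
rewrite !lebesgue_measure_itv/= !lte_fin ltr_pM2r ?invr_gt0//.
case: ifP => _; last by rewrite mule0.
by rewrite -!EFinB -EFinM -mulrBl mulrCA divff ?mulr1// gt_eqF.
Qed.

(** Change of variables read off the measure identity, so measurability suffices; the half-line is
    invariant under positive dilations. *)
Lemma ge0_integral_scale {R : realType} (c : R) (f : R -> \bar R) :
  0 < c -> measurable_fun [set: R] f -> (forall x, (0 <= f x)%E) ->
  (\int[@lebesgue_measure R]_(x in `[0%R, +oo[) f x
  = c%:E * \int[@lebesgue_measure R]_(x in `[0%R, +oo[) f (c * x)%R)%E.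
Proof.
move=> c0 mf f0.
have mc := @measurable_lebesgue_dilation R c.
pose c' : {nonneg R} := NngNum (ltW c0).
pose nu : {measure set (measurableTypeR R) -> \bar R} :=
  measure_function_pushforward__canonical__measure_function_Measure
    lebesgue_measure mc.
rewrite [LHS](@eq_measure_integral _ _ _ _ (mscale c' nu)); last first.
  by move=> A mA _; exact: lebesgue_measure_scale.
rewrite ge0_integral_mscale//=; last exact: measurable_funS mf.
congr (_ * _)%E.
rewrite ge0_integral_pushforward//=; last exact: measurable_funS mf.
rewrite (_ : _ @^-1` _ = `[0, +oo[%classic)//.
by apply/seteqP; split=> x /=; rewrite !in_itv/= !andbT pmulr_rge0.
Qed.

Lemma integral0y_gauss_scale {R : realType} (t : R) : 0 < t ->
  (\int[@lebesgue_measure R]_(y in `[0%R, +oo[) (expR (- (t * y ^+ 2)))%:E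
  = (Num.sqrt pi / 2 * t `^ (- 2^-1))%:E)%E.
Proof.
move=> t0; have st0 : 0 < Num.sqrt t by rewrite sqrtr_gt0.
have mg : measurable_fun [set: R] (fun y : R => (gauss_fun y)%:E).
  by apply/measurable_EFinP; exact: measurable_gauss_fun.
have g0 (x : R) : (0 <= (gauss_fun x)%:E)%E by rewrite lee_fin gauss_fun_ge0.
have := ge0_integral_scale _ _ st0 mg g0; rewrite integral0y_gauss.
under [X in _ = (_ * X)%E -> _]eq_integral
  do rewrite /gauss_fun exprMn sqr_sqrtr ?ltW//.
move=> /(congr1 (fun x => (Num.sqrt t)^-1%:E * x)%E).
rewrite muleA -!EFinM mulVf ?gt_eqF// mul1e => <-.
by rewrite powRN powR12_sqrt ?ltW// mulrC.
Qed.

(** Kept in the extended reals: [Gamma] takes [fine], which would send an infinite integral to 0, so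
    finiteness has to be proved before passing to [Gamma]. *)
Definition gamma_integral {R : realType} (s : R) : \bar R :=
  (\int[@lebesgue_measure R]_(t in `]0%R, +oo[) (t `^ (s - 1) * expR (- t))%:E)%E.

(** Taken over the half-line, hence half of the constant [c s] of the overview, by evenness. *)
Definition student_integral {R : realType} (s : R) : \bar R :=
  (\int[@lebesgue_measure R]_(y in `[0%R, +oo[) ((1 + y ^+ 2) `^ (- s))%:E)%E.

Lemma measurable_gamma_integrand {R : realType} (s c : R) :
  measurable_fun [set: R] (fun t => t `^ (s - 1) * expR (- (c * t))).
Proof.
apply: measurable_funM; first exact: measurable_powR.
by apply: measurableT_comp => //; apply: measurableT_comp.
Qed.

Lemma gamma_integral_cbnd {R : realType} (s : R) :
  gamma_integral s =
  (\int[@lebesgue_measure R]_(t in `[0%R, +oo[) (t `^ (s - 1) * expR (- t))%:E)%E.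
Proof.
rewrite /gamma_integral integral_itv_obnd_cbnd//.
apply/measurable_EFinP/(measurable_funS measurableT) => //.
by have := measurable_gamma_integrand s 1; under eq_fun do rewrite mul1r.
Qed.

(** Substitution [t := c * t]; with [c = 1 + y^2] the factor [c^-s] becomes the Student
    integrand. *)
Lemma gamma_integral_scale {R : realType} (s c : R) : 0 < c ->
  ((c `^ (- s))%:E * gamma_integral s =
  \int[@lebesgue_measure R]_(t in `[0%R, +oo[) (t `^ (s - 1) * expR (- (c * t)))%:E)%E.
Proof.
move=> c0.
rewrite gamma_integral_cbnd.
rewrite (@ge0_integral_scale R c (fun t => (t `^ (s - 1) * expR (- t))%:E) c0); last 2 first.
- apply/measurable_EFinP.
  by have := measurable_gamma_integrand s 1; under eq_fun do rewrite mul1r.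
- by move=> x; rewrite lee_fin mulr_ge0 ?powR_ge0 ?expR_ge0.
rewrite muleA -EFinM -ge0_integralZl_EFin//; last 3 first.
- by move=> x _; rewrite lee_fin mulr_ge0 ?powR_ge0 ?expR_ge0.
- apply/measurable_EFinP/(measurable_funS measurableT) => //.
  have mp := @measurable_powR R (s - 1).
  apply: measurable_funM; first by apply: (measurableT_comp mp).
  by apply: measurableT_comp => //; apply: measurableT_comp.
- by rewrite mulr_ge0 ?powR_ge0 ?ltW.
apply: eq_integral => t; rewrite inE/= in_itv/= andbT => t0.
rewrite -EFinM; congr EFin; rewrite powRM ?(ltW c0)// !mulrA; congr (_ * _).
rewrite -{2}[c]powRr1 ?ltW// -!powRD ?(gt_eqF c0) ?implybT//.
by rewrite (_ : - s + 1 + (s - 1) = 0) ?powRr0 ?mul1r//; ring.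
Qed.

(** Extend [f] by zero outside the rectangle and apply Tonelli on the whole product space. *)
Lemma fubini_tonelli_setX {R : realType} d1 d2
    (T1 : measurableType d1) (T2 : measurableType d2)
    (m1 : {sigma_finite_measure set T1 -> \bar R})
    (m2 : {sigma_finite_measure set T2 -> \bar R})
    (A : set T1) (B : set T2) (f : T1 * T2 -> \bar R) :
  measurable A -> measurable B -> measurable_fun [set: T1 * T2] f ->
  (forall z, (0 <= f z)%E) ->
  (\int[m1]_(x in A) \int[m2]_(y in B) f (x, y)
  = \int[m2]_(y in B) \int[m1]_(x in A) f (x, y))%E.
Proof.
move=> mA mB mf f0; pose g := f \_ (A `*` B).
have mg : measurable_fun setT g.
  by apply/(measurable_restrictT _ _).1; [exact: measurableX|exact: measurable_funS mf].
have g0 z : (0 <= g z)%E by exact: erestrict_ge0.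
transitivity (\int[m1]_x \int[m2]_y g (x, y))%E.
  rewrite integral_mkcond; apply: eq_integral => x _; rewrite patchE.
  case: ifPn => xA.
    rewrite integral_mkcond; apply: eq_integral => y _.
    by rewrite /g !patchE in_setX/= xA.
  by rewrite integral0_eq// => y _; rewrite /g patchE in_setX (negbTE xA).
rewrite (fubini_tonelli _ mg g0); apply/esym.
rewrite integral_mkcond; apply: eq_integral => y _; rewrite patchE.
case: ifPn => yB.
  rewrite integral_mkcond; apply: eq_integral => x _.
  by rewrite /g !patchE in_setX/= yB andbT.
by rewrite integral0_eq// => x _; rewrite /g patchE in_setX (negbTE yB) andbF.
Qed.

(** Integrate [t^(s-1) * exp (- t (1 + y^2))] in both orders: first in [t] gives
    [Gamma s * (1 + y^2)^-s], first in [y] gives a Gaussian integral and lowers the power of [t] by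
    1/2. The identity holds in the extended reals, so it can also transfer finiteness. *)
Lemma student_integralM_gamma {R : realType} (s : R) :
  (student_integral s * gamma_integral s
  = (Num.sqrt pi / 2)%:E * gamma_integral (s - 2^-1))%E.
Proof.
pose h (z : R * R) : R := z.2 `^ (s - 1) * expR (- ((1 + z.1 ^+ 2) * z.2)).
have mh : measurable_fun [set: R * R] h.
  have mp := @measurable_powR R (s - 1).
  apply: measurable_funM; first by apply: (measurableT_comp mp).
  apply: measurableT_comp => //; apply: measurableT_comp => //.
  apply: measurable_funM => //; apply: measurable_funD => //.
  exact: measurable_funX.
have h0 z : (0 <= (h z)%:E)%E by rewrite lee_fin mulr_ge0 ?powR_ge0 ?expR_ge0.
have mst : measurable_fun (`[0%R, +oo[%classic : set R) (fun y : R => (1 + y ^+ 2) `^ (- s)).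
  have mp := @measurable_powR R (- s).
  apply: (measurable_funS measurableT) => //; apply: (measurableT_comp mp).
  apply: measurable_funD => //; exact: measurable_funX.
have gam0 (u : R) : (0 <= gamma_integral u)%E.
  by apply: integral_ge0 => t _; rewrite lee_fin mulr_ge0 ?powR_ge0 ?expR_ge0.
rewrite /student_integral -ge0_integralZr//; last 2 first.
- exact/measurable_EFinP.
- by move=> y _; rewrite lee_fin powR_ge0.
transitivity (\int[@lebesgue_measure R]_(y in `[0%R, +oo[)
    \int[@lebesgue_measure R]_(t in `]0%R, +oo[) (h (y, t))%:E)%E.
  apply: eq_integral => y _; rewrite gamma_integral_scale; last first.
    by rewrite ltr_pwDl// sqr_ge0.
  rewrite integral_itv_obnd_cbnd//; apply/measurable_EFinP.
  apply: (measurable_funS measurableT) => //.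
  by have := measurable_gamma_integrand s (1 + y ^+ 2).
have mEh : measurable_fun setT (fun z : measurableTypeR R * measurableTypeR R =>
    (h z)%:E) by exact/measurable_EFinP.
have := @fubini_tonelli_setX _ _ _ _ _ (@lebesgue_measure R) (@lebesgue_measure R)
  `[0%R, +oo[%classic `]0%R, +oo[%classic _ (measurable_itv _) (measurable_itv _)
  mEh h0.
move=> ->.
rewrite -ge0_integralZl_EFin//; last 2 first.
- by move=> t _; rewrite lee_fin mulr_ge0 ?powR_ge0 ?expR_ge0.
- apply/measurable_EFinP/(measurable_funS measurableT) => //.
  have := measurable_gamma_integrand (s - 2^-1) 1.
  by under eq_fun do rewrite mul1r.
apply: eq_integral => t; rewrite inE/= in_itv/= andbT => t0.
transitivity (\int[@lebesgue_measure R]_(y in `[0%R, +oo[)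
  ((t `^ (s - 1) * expR (- t))%:E * (expR (- (t * y ^+ 2)))%:E))%E.
  apply: eq_integral => y _; rewrite -EFinM /h/= -mulrA -expRD.
  by congr (_ * expR _)%:E; ring.
rewrite ge0_integralZl_EFin//; last 2 first.
- apply/measurable_EFinP/(measurable_funS measurableT) => //.
  apply: measurableT_comp => //; apply: measurableT_comp => //.
  by apply: measurable_funM => //; exact: measurable_funX.
- by rewrite mulr_ge0 ?powR_ge0 ?expR_ge0.
rewrite integral0y_gauss_scale// -!EFinM; congr EFin.
have -> : s - 2^-1 - 1 = (s - 1) - 2^-1 by ring.
by rewrite [X in _ = _ * (X * _)]powRD ?(gt_eqF t0) ?implybT//; ring.
Qed.

(** * Finiteness and positivity of the two integrals *)

(** From [ln (c t) < c t] one gets [p ln t <= p c t - p ln c]; the choice [c = 1 / (2 (p + 1))]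
    makes [p c <= 1/2]. *)
Lemma powR_le_expR_half {R : realType} (p t : R) : 0 <= p -> 0 < t ->
  t `^ p <= expR (- (p * ln (2 * (p + 1))^-1)) * expR (t / 2).
Proof.
move=> p0 t0; set c := (2 * (p + 1))^-1.
have c0 : 0 < c by rewrite invr_gt0 mulr_gt0// ltr_wpDl.
rewrite /powR gt_eqF// -expRD ler_expR.
have : ln (c * t) < c * t by apply: ln_sublinear; rewrite mulr_gt0.
rewrite lnM ?posrE// => /ltW lnct.
have lnt : ln t <= c * t - ln c by lra.
have := ler_wpM2l p0 lnt.
have pc : p * c <= 2^-1.
  by rewrite /c invfM mulrCA ler_piMr// ler_pdivrMr ?mul1r ?lerDl// ltr_wpDl.
have := ler_wpM2r (ltW t0) pc.
rewrite mulrBr mulrA; lra.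
Qed.

(** The integrand is at most [K * exp (- t / 2)], which is [2 K] times the exponential density of
    rate 1/2, of total mass 1. *)
Lemma gamma_integral_lty_ge1 {R : realType} (s : R) : 1 <= s ->
  (gamma_integral s < +oo)%E.
Proof.
move=> s1; have p0 : 0 <= s - 1 by rewrite subr_ge0.
set K := expR (- ((s - 1) * ln (2 * ((s - 1) + 1))^-1)).
have h0 : (0 : R) < 2^-1 by rewrite invr_gt0.
have mpdf : measurable_fun [set: R] (EFin \o exponential_pdf (2^-1 : R)).
  by apply/measurable_EFinP; exact: measurable_exponential_pdf.
have pdf0 (x : R) : (0 <= (EFin \o exponential_pdf (2^-1 : R)) x)%E.
  by rewrite lee_fin exponential_pdf_ge0// ltW.
apply: (@le_lt_trans _ _ ((K * 2)%:E *
    \int[@lebesgue_measure R]_x (exponential_pdf 2^-1 x)%:E)%E); last first.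
  by rewrite integral_exponential_pdf// mule1 ltry.
rewrite -ge0_integralZl_EFin//; last by rewrite mulr_ge0 ?expR_ge0.
apply: (@le_trans _ _ (\int[@lebesgue_measure R]_(x in `]0%R, +oo[)
    ((K * 2)%:E * (exponential_pdf 2^-1 x)%:E))%E).
  apply: ge0_le_integral => //.
  - by move=> t _; rewrite lee_fin mulr_ge0 ?powR_ge0 ?expR_ge0.
  - apply/measurable_EFinP/(measurable_funS measurableT) => //.
    by have := measurable_gamma_integrand s 1; under eq_fun do rewrite mul1r.
  - by apply: (measurable_funS measurableT) => //; exact: measurable_funeM.
  move=> t /=; rewrite in_itv/= andbT => t0.
  rewrite -EFinM lee_fin exponential_pdfE ?(ltW t0)//.
  have /(_ t0) := @powR_le_expR_half R (s - 1) t p0.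
  rewrite -/K => /(ler_wpM2r (expR_ge0 (- t))) /le_trans; apply.
  rewrite -mulrA -expRD mulrA mulfK// (_ : t / 2 - t = - 2^-1 * t)//.
  by field.
apply: ge0_subset_integral => //.
- exact: measurable_funeM.
- move=> x _; apply: mule_ge0; last exact: pdf0.
  by rewrite lee_fin mulr_ge0 ?expR_ge0.
by move=> x _; exact: pdf0.
Qed.

Lemma is_derive_powR1D {R : realType} (a x : R) : 0 <= x ->
  is_derive x 1 (fun y : R => (1 + y) `^ a) (a * (1 + x) `^ (a - 1)).
Proof.
move=> x0; have x1 : 0 < 1 + x by rewrite ltr_pwDl.
have := is_derive1_powR a x1 => d1.
have := @is_derive1_comp R (fun y => y `^ a) (fun y => 1 + y) x _ 1 d1.
by rewrite mulr1; apply; rewrite -[X in is_derive _ _ _ X]add0r; apply: is_deriveD.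
Qed.

Lemma powR1D_cvgy {R : realType} (b : R) : 0 < b ->
  (1 + y) `^ (- b) @[y --> +oo] --> (0 : R).
Proof.
move=> b0; apply/cvgr0Pnorm_lt => e e0; near=> y.
have y0 : 0 < 1 + y by rewrite ltr_wpDl.
rewrite ger0_norm ?powR_ge0// powRN -[e]invrK ltf_pV2 ?posrE ?powR_gt0 ?invr_gt0//.
(* The threshold for [1 + y] is [e^(-1/b)]. *)
have -> : e^-1 = (e^-1 `^ b^-1) `^ b.
  by rewrite -powRrM mulVf ?gt_eqF// powRr1// invr_ge0 ltW.
apply: gt0_ltr_powR; rewrite ?nnegrE ?powR_ge0// ?ltW//.
by rewrite ltr_wpDl//; near: y; exact: nbhs_pinfty_gt.
Unshelve. all: by end_near. Qed.

Lemma integral_powR1D {R : realType} (b : R) : 0 < b ->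
  (\int[@lebesgue_measure R]_(y in `[0%R, +oo[) ((1 + y) `^ (- b - 1))%:E
   = b^-1%:E)%E.
Proof.
move=> b0.
rewrite (@ge0_continuous_FTC2y _ _ (fun y => - b^-1 * (1 + y) `^ (- b)) _ 0).
- by rewrite addr0 powR1 mulr1 -EFinB sub0r opprK.
- by move=> x _; exact: powR_ge0.
- apply: derivable_within_continuous => x; rewrite in_itv/= andbT => x0.
  by have [] := @is_derive_powR1D R (- b - 1) x x0.
- by rewrite -[X in _ --> X](mulr0 (- b^-1)); apply: cvgMr; exact: powR1D_cvgy.
- move=> x x0; apply: derivableM => //.
  by have [] := @is_derive_powR1D R (- b) x (ltW x0).
- apply: cvg_at_right_filter; apply: cvgMr.
  have [+ _] := @is_derive_powR1D R (- b) 0 (lexx _).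
  by move=> /derivable1_diffP/differentiable_continuous.
- move=> x; rewrite in_itv/= andbT => x0.
  rewrite derive1E deriveM//; last by have [] := @is_derive_powR1D R (- b) x (ltW x0).
  have [_ ->] := @is_derive_powR1D R (- b) x (ltW x0).
  by rewrite derive_cst scaler0 addr0 /GRing.scale/= mulrA mulrNN mulVf ?mul1r// gt_eqF.
Qed.

Lemma measurable_powR_1Dsqr {R : realType} (s : R) :
  measurable_fun [set: R] (fun y : R => (1 + y ^+ 2) `^ s).
Proof.
have mp := @measurable_powR R s; apply: (measurableT_comp mp).
by apply: measurable_funD => //; exact: measurable_funX.
Qed.

(** Since [(1 + y)^2 <= 2 (1 + y^2)], the integrand is at most [2^s * (1 + y)^(-2 s)], integrable
    because [2 s > 1]. *)
Lemma student_integral_lty {R : realType} (s : R) : 2^-1 < s ->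
  (student_integral s < +oo)%E.
Proof.
move=> s2; have b0 : 0 < 2 * s - 1 by lra.
have s0 : 0 <= s by lra.
apply: (@le_lt_trans _ _ ((2 `^ s)%:E * \int[@lebesgue_measure R]_(y in `[0%R, +oo[)
    ((1 + y) `^ (- (2 * s - 1) - 1))%:E)%E); last first.
  by rewrite integral_powR1D// -EFinM ltry.
have m1 : measurable_fun (`[0%R, +oo[%classic : set R)
    (fun y : R => ((1 + y) `^ (- (2 * s - 1) - 1))%:E).
  apply/measurable_EFinP/(measurable_funS measurableT) => //.
  have mp := @measurable_powR R (- (2 * s - 1) - 1).
  by apply: (measurableT_comp mp); exact: measurable_funD.
rewrite -ge0_integralZl_EFin ?powR_ge0//; last first.
  by move=> y _; rewrite lee_fin powR_ge0.
apply: ge0_le_integral => //.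
- by move=> y _; rewrite lee_fin powR_ge0.
- apply/measurable_EFinP/(measurable_funS measurableT) => //.
  exact: measurable_powR_1Dsqr.
- exact: measurable_funeM.
move=> y /=; rewrite in_itv/= andbT => y0; rewrite -EFinM lee_fin.
rewrite (_ : - (2 * s - 1) - 1 = 2 * (- s)); last by ring.
have y1 : 0 < 1 + y by rewrite ltr_pwDl.
have y2 : 0 < 1 + y ^+ 2 by rewrite ltr_pwDl// sqr_ge0.
rewrite powRrM (_ : (1 + y) `^ 2 = (1 + y) ^+ 2); last by rewrite powR_mulrn ?ltW.
rewrite !powRN -[leRHS]invrK lef_pV2 ?posrE ?invr_gt0 ?divr_gt0 ?powR_gt0 ?exprn_gt0//.
rewrite invf_div ler_pdivrMr ?powR_gt0// -powRM ?(ltW y2)// ?ler0n//.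
apply: ge0_ler_powR => //; rewrite ?nnegrE ?sqr_ge0 ?mulr_ge0 ?(ltW y2)//.
by have := sqr_ge0 (y - 1); rewrite !expr2; lra.
Qed.

Lemma gamma_integral_ge0 {R : realType} (s : R) : (0 <= gamma_integral s)%E.
Proof.
by apply: integral_ge0 => t _; rewrite lee_fin mulr_ge0 ?powR_ge0 ?expR_ge0.
Qed.

Lemma student_integral_ge0 {R : realType} (s : R) : (0 <= student_integral s)%E.
Proof. by apply: integral_ge0 => t _; rewrite lee_fin powR_ge0. Qed.

(* The identity with student_integral lowers the argument by 1/2, so two steps
   go from [1, +oo[ down to ]0, +oo[. *)
Lemma gamma_integral_lty {R : realType} (s : R) : 0 < s ->
  (gamma_integral s < +oo)%E.
Proof.
have step (u : R) : 0 < u -> (gamma_integral (u + 2^-1) < +oo)%E ->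
    (gamma_integral u < +oo)%E.
  move=> u0 fu; have := student_integralM_gamma (u + 2^-1); rewrite addrK.
  have sp : 0 < Num.sqrt pi / 2 :> R by rewrite divr_gt0// sqrtr_gt0 pi_gt0.
  have : (student_integral (u + 2^-1) * gamma_integral (u + 2^-1) < +oo)%E.
    apply: lte_mul_pinfty => //; first exact: student_integral_ge0.
    rewrite ge0_fin_numE ?student_integral_ge0//.
    by apply: student_integral_lty; rewrite ltrDr.
  move=> + eq; rewrite eq.
  have := @gamma_integral_ge0 R u; case: (gamma_integral u) => [r _ _| |]//=.
    by rewrite ltry.
  by rewrite mulry gtr0_sg// mul1e ltxx.
move=> s0; apply: (step) => //; apply: (step); first by rewrite addr_gt0.
by apply: gamma_integral_lty_ge1; lra.
Qed.

(** On [[1, 2]] the integrand is at least the positive constant [e]; the absolute value in [e]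
    covers both signs of [s - 1]. *)
Lemma gamma_integral_gt0 {R : realType} (s : R) : (0 < gamma_integral s)%E.
Proof.
pose e : R := (2 `^ `|s - 1|)^-1 * expR (- 2).
have e0 : 0 < e by rewrite mulr_gt0 ?expR_gt0 ?invr_gt0 ?powR_gt0.
have mg : measurable_fun [set: R] (fun t : R => (t `^ (s - 1) * expR (- t))%:E).
  apply/measurable_EFinP.
  by have := measurable_gamma_integrand s 1; under eq_fun do rewrite mul1r.
apply: (@lt_le_trans _ _ (\int[@lebesgue_measure R]_(t in `[1%R, 2%R]) e%:E)%E).
  rewrite integral_cst//= lebesgue_measure_itv/= lte_fin ltr1n.
  by rewrite -EFinB -EFinM lte_fin mulr_gt0// subr_gt0 ltr1n.
apply: (@le_trans _ _ (\int[@lebesgue_measure R]_(t in `[1%R, 2%R])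
    (t `^ (s - 1) * expR (- t))%:E)%E).
  apply: ge0_le_integral => //; first by move=> t _; rewrite lee_fin ltW.
    exact: measurable_funS mg.
  move=> t /=; rewrite in_itv/= => /andP[t1 t2]; rewrite lee_fin.
  apply: ler_pM; rewrite ?expR_ge0 ?invr_ge0 ?powR_ge0//; last first.
    by rewrite ler_expR lerN2.
  apply: (@le_trans _ _ (t `^ (- `|s - 1|))); last first.
    by apply: ler_powR => //; rewrite lerNl -normrN ler_norm.
  rewrite powRN lef_pV2 ?posrE ?powR_gt0 ?(lt_le_trans _ t1)//.
  by apply: ge0_ler_powR => //; rewrite nnegrE ?(le_trans ler01 t1).
apply: ge0_subset_integral => //.
- exact: measurable_funS mg.
- by move=> t _; rewrite lee_fin mulr_ge0 ?powR_ge0 ?expR_ge0.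
- by move=> t /=; rewrite !in_itv/= andbT => /andP[t1 _]; rewrite (lt_le_trans _ t1).
Qed.

Lemma Gamma_EFin {R : realType} (s : R) : 0 < s -> gamma_integral s = (Gamma s)%:E.
Proof.
move=> s0; rewrite [RHS]fineK// ge0_fin_numE ?gamma_integral_ge0//.
exact: gamma_integral_lty.
Qed.

Lemma Gamma_gt0 {R : realType} (s : R) : 0 < s -> 0 < Gamma s.
Proof. by move=> s0; rewrite -lte_fin -Gamma_EFin// gamma_integral_gt0. Qed.

(** Closed form of the integral [c s] over the whole line, valid for [s > 1/2]. *)
Definition student_const {R : realType} (s : R) : R :=
  Num.sqrt pi * Gamma (s - 2^-1) / Gamma s.

Lemma student_const_gt0 {R : realType} (s : R) : 2^-1 < s -> 0 < student_const s.
Proof.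
move=> s2; rewrite divr_gt0 ?mulr_gt0 ?sqrtr_gt0 ?pi_gt0 ?Gamma_gt0 ?subr_gt0//.
by apply: lt_trans s2; rewrite invr_gt0.
Qed.

Lemma student_integralE {R : realType} (s : R) : 2^-1 < s ->
  student_integral s = (student_const s / 2)%:E.
Proof.
move=> s2; have s0 : 0 < s by apply: lt_trans s2; rewrite invr_gt0.
have := student_integralM_gamma s; rewrite !Gamma_EFin ?subr_gt0//.
have := @student_integral_ge0 R s; have := student_integral_lty _ s2.
case: (student_integral s) => // r _ _; rewrite -!EFinM => -[rG].
have G0 : Gamma s != 0 by rewrite gt_eqF ?Gamma_gt0.
rewrite -(mulfK G0 r) rG /student_const; congr EFin; ring.
Qed.

(** * Sums over the integers *)

Lemma itv0y_bigcup {R : realType} :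
  `[0%R, +oo[%classic = \bigcup_(n : nat) `[n%:R, n.+1%:R[%classic :> set R.
Proof.
apply/seteqP; split=> [x /=|x [n _] /=]; rewrite !in_itv/= ?andbT.
  move=> x0.
  exists (Num.truncn x) => //=.
  by rewrite in_itv/= truncn_itv.
by move=> /andP[nx _]; rewrite (le_trans _ nx).
Qed.

Lemma trivIset_itv_nat {R : realType} :
  trivIset setT (fun n : nat => `[n%:R, n.+1%:R[%classic : set R).
Proof.
apply: ltn_trivIset => n m nm; apply/seteqP; split=> // x [] /=.
rewrite !in_itv/= => /andP[_ xm] /andP[nx _].
by have := le_lt_trans nx xm; rewrite ltr_nat ltnNge nm.
Qed.

(** Integral test: on each unit cell [[n, n+1[] monotonicity keeps [f] between [f (n+1)] and
    [f n]. *)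
Lemma integral_series_bounds {R : realType} (f : R -> R) :
  (forall x, 0 <= x -> 0 <= f x) ->
  (forall x y, 0 <= x -> x <= y -> f y <= f x) ->
  measurable_fun (`[0%R, +oo[%classic : set R) f ->
  (\sum_(n <oo) (f n.+1%:R)%:E
     <= \int[@lebesgue_measure R]_(x in `[0%R, +oo[) (f x)%:E
     <= \sum_(n <oo) (f n%:R)%:E)%E.
Proof.
move=> f0 fle mf.
have sub n : `[n%:R, n.+1%:R[%classic `<=` (`[0%R, +oo[%classic : set R).
  by move=> x /=; rewrite !in_itv/= andbT => /andP[nx _]; rewrite (le_trans _ nx).
have mn (n : nat) : measurable_fun (`[n%:R, n.+1%:R[%classic : set R) (EFin \o f).
  by apply/measurable_EFinP; apply: measurable_funS mf.
have len (n : nat) (r : R) : (\int[@lebesgue_measure R]_(x in `[n%:R, n.+1%:R[) r%:E)%E = r%:E.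
  rewrite integral_cst//= lebesgue_measure_itv/= lte_fin ltr_nat ltnSn.
  by rewrite -EFinB -natrB// subSnn mule1.
rewrite itv0y_bigcup ge0_integral_bigcup//; last 3 first.
- by rewrite -itv0y_bigcup; apply/measurable_EFinP.
- by rewrite -itv0y_bigcup => x /=; rewrite in_itv/= andbT lee_fin => /f0.
- exact: trivIset_itv_nat.
apply/andP; split; apply: lee_nneseries.
- by move=> n _ _; rewrite lee_fin f0.
- move=> n _; rewrite -[leLHS](len n); apply: ge0_le_integral => //.
  + by move=> x _; rewrite lee_fin f0.
  + exact: mn.
  + move=> x /=; rewrite in_itv/= => /andP[nx xn].
    by rewrite lee_fin fle// ?(ltW xn)// (le_trans _ nx).
- by move=> n _ _; apply: integral_ge0 => x /sub /=; rewrite in_itv/= andbT lee_fin => /f0.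
- move=> n _; rewrite -[leRHS](len n); apply: ge0_le_integral => //.
  + by move=> x /sub /=; rewrite in_itv/= andbT lee_fin => /f0.
  + exact: mn.
  + by move=> x /=; rewrite in_itv/= => /andP[nx xn]; rewrite lee_fin fle.
Qed.

(** [Negz n] is [-(n+1)], so the second series starts at -1 and 0 is counted once. *)
Lemma esum_int {R : realType} (g : int -> \bar R) : (forall z, (0 <= g z)%E) ->
  (\esum_(z in [set: int]) g z
  = \sum_(n <oo) g (Posz n) + \sum_(n <oo) g (Negz n))%E.
Proof.
move=> g0; rewrite (esumID (range Posz)) ?setTI//.
have -> : ~` range Posz = range Negz.
  apply/seteqP; split=> [[n|n] /= nz|_ [n _ <-] [m]//]; last by exists n.
  by exfalso; apply: nz; exists n.
rewrite !nneseries_esumT//.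
by congr (_ + _)%E; rewrite esum_image// => x y _ _ [].
Qed.

(** With [T] the sum over [n >= 1], evenness gives [S = f 0 + 2 T], and the integral test gives
    [T <= I <= f 0 + T]; the first inequality also makes [T] finite. *)
Lemma esum_int_integral {R : realType} (f : R -> R) (I : R) :
  (forall x, 0 <= x -> 0 <= f x) ->
  (forall x y, 0 <= x -> x <= y -> f y <= f x) ->
  (forall x, f (- x) = f x) ->
  measurable_fun (`[0%R, +oo[%classic : set R) f ->
  (\int[@lebesgue_measure R]_(x in `[0%R, +oo[) (f x)%:E = I%:E)%E ->
  exists2 S, (\esum_(z in [set: int]) (f z%:~R)%:E = S%:E)%E &
    2 * I - f 0 <= S <= 2 * I + f 0.
Proof.
move=> f0 fle feven mf fI.
have := integral_series_bounds _ f0 fle mf; rewrite fI.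
have fz (z : int) : (0 <= (f z%:~R)%:E)%E.
  rewrite lee_fin; case: z => n; first exact: f0.
  by rewrite NegzE mulrNz feven f0.
rewrite esum_int//.
set T := (\sum_(n <oo) (f n.+1%:R)%:E)%E.
have -> : (\sum_(n <oo) (f (Negz n)%:~R)%:E = T)%E.
  by apply: eq_eseriesr => n _; rewrite NegzE mulrNz feven.
have -> : (\sum_(n <oo) (f (Posz n)%:~R)%:E = (f 0)%:E + T)%E.
  rewrite nneseries_recl// -(@nneseries_addn R (fun n => (f n%:~R)%:E) 1)//.
  by congr (_ + _)%E; apply: eq_eseriesr => n _; rewrite addn1.
have T0 : (0 <= T)%E by apply: nneseries_ge0 => n _ _; rewrite lee_fin f0.
case: T T0 => [t _| _ /andP[]|]//.
rewrite -!EFinD !lee_fin => /andP[tI It]; exists (f 0 + t + t) => //; lra.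
Qed.

(* The number [B ^ (1 / 2 - s)] bounds the error term [f 0 = B ^ - s] because
   [1 <= B]; this makes the error relative, hence easy to iterate. *)
Lemma lattice_sum_bounds {R : realType} (C B a s eta : R) :
  0 <= C -> 1 <= B -> 2^-1 < s -> 0 < a -> 0 < eta < 1 ->
  1 <= eta * (a * student_const s) ->
  let X := C * (a * student_const s) * B `^ (- (s - 2^-1)) in
  exists2 S, (\esum_(z in [set: int])
      (C * (B + z%:~R ^+ 2 / a ^+ 2) `^ (- s))%:E = S%:E)%E &
    (1 - eta) * X <= S <= (1 - eta)^-1 * X.
Proof.
move=> C0 B1 s2 a0 /andP[eta0 eta1] ha X.
have B0 : 0 < B by rewrite (lt_le_trans _ B1).
have s0 : 0 < s by apply: lt_trans s2; rewrite invr_gt0.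
have c0 := student_const_gt0 _ s2.
pose f (x : R) := C * (B + x ^+ 2 / a ^+ 2) `^ (- s).
have Bx (x : R) : 0 < B + x ^+ 2 / a ^+ 2.
  by rewrite ltr_wpDr// divr_ge0 ?sqr_ge0.
have f0 (x : R) : 0 <= f x by rewrite mulr_ge0 ?powR_ge0.
have fle (x y : R) : 0 <= x -> x <= y -> f y <= f x.
  move=> x0 xy; apply: ler_wpM2l => //.
  rewrite !powRN lef_pV2 ?posrE ?powR_gt0 ?Bx//.
  apply: ge0_ler_powR; rewrite ?nnegrE ?(ltW s0) ?(ltW (Bx _))//.
  rewrite lerD2l ler_pM2r ?invr_gt0 ?exprn_gt0// ler_sqr ?nnegrE//.
  exact: le_trans xy.
have mf : measurable_fun [set: R] f.
  have mp := @measurable_powR R (- s).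
  apply: measurable_funM => //; apply: (measurableT_comp mp).
  by apply: measurable_funD => //; apply: measurable_funM.
have fI : (\int[@lebesgue_measure R]_(x in `[0%R, +oo[) (f x)%:E = (X / 2)%:E)%E.
  have sB : 0 < Num.sqrt B by rewrite sqrtr_gt0.
  have aB : 0 < a * Num.sqrt B by rewrite mulr_gt0.
  (* Substituting [x = a * sqrt B * y] turns [B + x^2 / a^2] into [B (1 + y^2)]; the Jacobian
     [sqrt B] raises the exponent [-s] of [B] to [1/2 - s]. *)
  rewrite (@ge0_integral_scale R _ (fun x => (f x)%:E) aB)//; last exact/measurable_EFinP.
  under eq_integral => y _.
    rewrite /f exprMn exprMn sqr_sqrtr ?ltW// -mulrA [X in B + X](_ : _ = B * y ^+ 2); last first.
      by field; rewrite gt_eqF.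
    rewrite -[X in X + _]mulr1 -mulrDr powRM ?(ltW B0) ?addr_ge0 ?sqr_ge0// mulrA EFinM.
    over.
  rewrite ge0_integralZl_EFin//; last 3 first.
  - by move=> y _; rewrite lee_fin powR_ge0.
  - apply/measurable_EFinP/(measurable_funS measurableT) => //.
    exact: measurable_powR_1Dsqr.
  - by rewrite mulr_ge0 ?powR_ge0.
  rewrite [X in (_ * (_ * X))%E](student_integralE s s2) -!EFinM; congr EFin.
  rewrite /X (_ : - (s - 2^-1) = 2^-1 + - s); last by ring.
  by rewrite powRD ?(gt_eqF B0) ?implybT// powR12_sqrt ?ltW//; ring.
have feven (x : R) : f (- x) = f x by rewrite /f sqrrN.
have [S -> /andP[S1 S2]] := esum_int_integral _ _ (fun x _ => f0 x) fle feven
  (measurable_funS measurableT (@subsetT _ _) mf) fI.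
exists S => //.
have X0 : 0 <= X by apply/mulr_ge0/powR_ge0/mulr_ge0/ltW/mulr_gt0.
have f0X : f 0 <= eta * X.
  have -> : eta * X = eta * (a * student_const s) * (C * B `^ (- (s - 2^-1))).
    by rewrite /X; ring.
  apply: (@le_trans _ _ (C * B `^ (- (s - 2^-1)))); last first.
    by apply: ler_peMl => //; rewrite mulr_ge0 ?powR_ge0.
  rewrite /f expr0n/= mul0r addr0; apply: ler_wpM2l => //.
  by apply: ler_powR => //; lra.
(* The upper factor [1 + eta] is weakened to the inverse of the lower one, so that both bounds
   iterate as powers of [1 - eta]. *)
have : 1 + eta <= (1 - eta)^-1.
  by rewrite -[leRHS]mul1r ler_pdivlMr ?subr_gt0//; nra.
move=> /(ler_wpM2r X0); lra.
Qed.

(** * Summation of the coordinates one at a time *)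

(** The prefix is indexed by [nat] so that its type does not change when [e] varies in the
    induction. *)
Definition lattice_fiber (d e : nat) (kp : nat -> int) : set {ffun 'I_d -> int} :=
  [set k | forall i : 'I_d, (i < e)%N -> k i = kp i].

Definition extend_prefix (e : nat) (l : int) (kp : nat -> int) : nat -> int :=
  fun i => if i == e then l else kp i.

Definition prefix_form {R : realType} (a : nat -> R) (e : nat) (kp : nat -> int) : R :=
  1 + \sum_(i < e) ((kp i)%:~R ^+ 2 / a i ^+ 2).

Lemma prefix_form_ge1 {R : realType} (a : nat -> R) e kp : 1 <= prefix_form a e kp.
Proof. by rewrite lerDl sumr_ge0// => i _; rewrite divr_ge0 ?sqr_ge0. Qed.

Lemma prefix_form_extend {R : realType} (a : nat -> R) e kp l :
  prefix_form a e.+1 (extend_prefix e l kp)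
  = prefix_form a e kp + l%:~R ^+ 2 / a e ^+ 2.
Proof.
rewrite /prefix_form big_ord_recr/= addrA /extend_prefix eqxx; congr (_ + _ + _).
by apply: eq_bigr => i _; rewrite ltn_eqF.
Qed.

(** The pairs [(l, k)] correspond bijectively to the points [k] of the larger fiber, [l] being
    coordinate [e] of [k]. *)
Lemma esum_lattice_fiberS {R : realType} (d e : nat) kp
    (w : {ffun 'I_d -> int} -> \bar R) : (e < d)%N -> (forall k, (0 <= w k)%E) ->
  (\esum_(k in lattice_fiber d e kp) w k
  = \esum_(l in [set: int])
      \esum_(k in lattice_fiber d e.+1 (extend_prefix e l kp)) w k)%E.
Proof.
move=> ed w0; rewrite esum_esum//; apply: (@reindex_esum _ _ _ _ _ snd w); split.
- move=> [l k] [_ /= kl] i ie; rewrite kl 1?ltnW// /extend_prefix.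
  by rewrite ltn_eqF.
- move=> [l1 k1] [l2 k2] /set_mem[_ /= h1] /set_mem[_ /= h2] k12; congr (_, _) => //.
  have := h1 (Ordinal ed) (ltnSn e); rewrite k12 h2 ?ltnSn//=.
  by rewrite /extend_prefix eqxx.
- move=> k kf; exists (k (Ordinal ed), k) => //; split => //= i.
  rewrite ltnS leq_eqVlt /extend_prefix => /orP[/eqP ie|ie].
    by rewrite ie eqxx; congr (k _); apply: val_inj.
  by rewrite ltn_eqF// kf.
Qed.

Lemma lattice_fiber_self (d : nat) kp :
  lattice_fiber d d kp = [set [ffun i : 'I_d => kp i]].
Proof.
apply/seteqP; split=> k /=.
  by move=> kf; apply/ffunP => i; rewrite ffunE kf.
by move=> -> i _; rewrite ffunE.
Qed.

Lemma half_lt_exponent {R : realType} (m : R) (i : nat) : 0 < m ->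
  2^-1 < (m + i.+1%:R) / 2.
Proof. by move=> m0; rewrite -[X in m + X]natr1; have := ler0n R i; lra. Qed.

(** Induction on the number [n] of free coordinates: the hypothesis bounds each inner sum by a
    multiple of [(B + l^2 / a_e^2)^-s], and the one-dimensional bound sums these over [l] at the
    cost of one more factor [1 - eta]. The factor [C] lets the same statement serve raw and
    normalized weights. *)
Lemma lattice_fiber_sum_bounds {R : realType} (d : nat) (m eta : R) (a : nat -> R) :
  0 < m -> 0 < eta < 1 ->
  (forall i, (i < d)%N -> 0 < a i) ->
  (forall i, (i < d)%N -> 1 <= eta * (a i * student_const ((m + i.+1%:R) / 2))) ->
  forall (n e : nat) kp (C : R), (e + n)%N = d -> 0 <= C ->
  let X := C * \prod_(e <= i < d) (a i * student_const ((m + i.+1%:R) / 2))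
             * prefix_form a e kp `^ (- ((m + e%:R) / 2)) in
  exists2 S, (\esum_(k in lattice_fiber d e kp)
      (C * tsallis_weight d m a k)%:E = S%:E)%E &
    (1 - eta) ^+ n * X <= S <= (1 - eta) ^- n * X.
Proof.
move=> m0 eta01 a0 aeta; have /andP[eta0 eta1] := eta01.
have q0 : 0 < 1 - eta by rewrite subr_gt0.
have w0 k : 0 <= tsallis_weight d m a k by exact: powR_ge0.
have sc0 i : 0 < student_const ((m + i.+1%:R) / 2).
  by apply: student_const_gt0; exact: half_lt_exponent.
elim=> [|n IH] e kp C.
  rewrite addn0 => -> C0 X; exists X; last by rewrite invr1 !mul1r lexx.
  rewrite lattice_fiber_self esum_set1 ?lee_fin ?mulr_ge0//.
  rewrite /X big_geq// mulr1; congr (_ * _ `^ _)%:E; congr (_ + _).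
  by apply: eq_bigr => i _; rewrite ffunE.
move=> en C0 X; have ed : (e < d)%N by rewrite -en addnS ltnS leq_addr.
pose P := \prod_(e.+1 <= i < d) (a i * student_const ((m + i.+1%:R) / 2)).
have P0 : 0 <= P.
  rewrite /P big_nat_cond; apply: prodr_ge0 => i /andP[/andP[_ id] _].
  by rewrite ltW// mulr_gt0// a0.
pose B := prefix_form a e kp.
pose s := (m + e.+1%:R) / 2.
have s2 : 2^-1 < s by exact: half_lt_exponent.
(* Coordinates count from 0, so summing out coordinate [e] uses [s = (m + e + 1) / 2] and leaves the
   exponent [s - 1/2 = (m + e) / 2]. *)
have XE : X = C * P * (a e * student_const s) * B `^ (- (s - 2^-1)).
  rewrite /X big_ltn// -/P (_ : s - 2^-1 = (m + e%:R) / 2) /s; last first.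
    by rewrite -[X in m + X]natr1; field.
  by rewrite -/B; ring.
have inner l : exists2 S, (\esum_(k in lattice_fiber d e.+1 (extend_prefix e l kp))
      (C * tsallis_weight d m a k)%:E = S%:E)%E &
    (1 - eta) ^+ n * (C * P * (B + l%:~R ^+ 2 / a e ^+ 2) `^ (- s)) <= S <=
    (1 - eta) ^- n * (C * P * (B + l%:~R ^+ 2 / a e ^+ 2) `^ (- s)).
  have := IH e.+1 (extend_prefix e l kp) C; rewrite addSnnS en prefix_form_extend.
  by apply.
have CP0 : 0 <= C * P by rewrite mulr_ge0.
have qn0 : 0 <= (1 - eta) ^+ n by rewrite exprn_ge0// ltW.
have qVn0 : 0 <= (1 - eta) ^- n by rewrite invr_ge0.
have lat D : 0 <= D -> _ := fun D0 => @lattice_sum_bounds R D B (a e) s eta D0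
  (prefix_form_ge1 _ _ _) s2 (a0 _ ed) eta01 (aeta _ ed).
(* [L] and [U] sum the lower and upper bounds of the inner sums over [l]; enclosing the full sum [T]
   between them also shows that it is finite. *)
have [L LE /andP[L1 _]] := lat _ (mulr_ge0 qn0 CP0).
have [U UE /andP[_ U1]] := lat _ (mulr_ge0 qVn0 CP0).
rewrite esum_lattice_fiberS//; last by move=> k; rewrite lee_fin mulr_ge0.
set T := (\esum_(l in _) _)%E.
have LT : (L%:E <= T)%E.
  rewrite -LE; apply: le_esum => l _; have [S -> /andP[h _]] := inner l.
  by rewrite lee_fin -mulrA.
have TU : (T <= U%:E)%E.
  rewrite -UE; apply: le_esum => l _; have [S -> /andP[_ h]] := inner l.
  by rewrite lee_fin -mulrA.
case: T LT TU => [t| |]//; rewrite !lee_fin => Lt tU; exists t => //.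
rewrite XE; apply/andP; split.
  apply: le_trans Lt; apply: le_trans L1; rewrite exprS le_eqVlt; apply/orP; left.
  by apply/eqP; ring.
apply: (le_trans tU); apply: (le_trans U1); rewrite exprS invfM le_eqVlt.
by apply/orP; left; apply/eqP; ring.
Qed.

(** * Product of the constants and elementary estimates *)

(** Telescoping: the numerator [Gamma ((m + i + 1) / 2 - 1/2)] of each factor is the denominator of
    the preceding one, and each factor contributes one [sqrt pi]. *)
Lemma prod_student_const {R : realType} (m : R) (n : nat) : 0 < m ->
  \prod_(i < n) student_const ((m + i.+1%:R) / 2)
  = pi `^ (n%:R / 2) * Gamma (m / 2) / Gamma ((m + n%:R) / 2).
Proof.
move=> m0; have G0 k : Gamma ((m + k%:R) / 2) != 0.
  by rewrite gt_eqF// Gamma_gt0// divr_gt0// ltr_wpDr.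
elim: n => [|n IH].
  have := G0 0%N; rewrite big_ord0 mul0r powRr0 addr0 mul1r => G.
  by rewrite divff.
rewrite big_ord_recr/= IH /student_const.
have -> : (m + n.+1%:R) / 2 - 2^-1 = (m + n%:R) / 2.
  by rewrite -[X in m + X]natr1; field.
have -> : pi `^ (n.+1%:R / 2) = pi `^ (n%:R / 2) * Num.sqrt pi :> R.
  rewrite -powR12_sqrt ?pi_ge0// -powRD ?gt_eqF ?pi_gt0 ?implybT//.
  by congr (_ `^ _); rewrite -natr1; field.
move: (G0 n) (G0 n.+1); move: (Gamma ((m + n%:R) / 2)) (Gamma ((m + n.+1%:R) / 2)).
move: (Gamma (m / 2)) (pi `^ (n%:R / 2)) (Num.sqrt pi) => g p r g1 g2 g1n0 g2n0.
by field; rewrite ?g1n0 ?g2n0.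
Qed.

Lemma bernoulli_ge {R : realType} (x : R) (n : nat) : 0 <= x <= 1 ->
  1 - n%:R * x <= (1 - x) ^+ n.
Proof.
move=> /andP[x0 x1]; elim: n => [|n IH]; first by rewrite mul0r subr0.
have q0 : 0 <= 1 - x by rewrite subr_ge0.
rewrite exprS; apply: le_trans (ler_wpM2l q0 IH).
by rewrite -natr1; have := mulr_ge0 (ler0n R n) (sqr_ge0 x); rewrite expr2; lra.
Qed.

(** Below, Bernoulli's inequality; above, also [1 / (1 - u) <= 1 + 2 u] for [u = n x <= 1/2]. *)
Lemma expr_bounds_near1 {R : realType} (x r : R) (n : nat) : 0 <= x < 1 ->
  n%:R * x <= 2^-1 -> (1 - x) ^+ n <= r <= (1 - x) ^- n ->
  `|r - 1| <= 2 * (n%:R * x).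
Proof.
move=> /andP[x0 x1] nx /andP[r1 r2].
have b : 1 - n%:R * x <= (1 - x) ^+ n by apply: bernoulli_ge; rewrite x0 ltW.
have nx0 : 0 <= n%:R * x by rewrite mulr_ge0.
have r3 : r <= 1 + 2 * (n%:R * x).
  apply: (le_trans r2); rewrite -[leLHS]mul1r ler_pdivrMr ?exprn_gt0 ?subr_gt0//.
  apply: (@le_trans _ _ ((1 + 2 * (n%:R * x)) * (1 - n%:R * x))).
    by nra.
  by apply: ler_wpM2l => //; lra.
by rewrite ler_norml; apply/andP; split; lra.
Qed.

(** * Limit of the normalized marginal *)

Theorem theorem9 (R : realType) (d d' : nat) (m : R)
    (hd : (2 <= d)%N) (hm : 0 < m) (hd'1 : (1 <= d')%N) (hd'2 : (d' <= d - 1)%N)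
    (kp : 'I_d' -> int) :
  forall eps : R, 0 < eps ->
  exists M : R, forall a : nat -> R,
    (forall i : nat, (i < d)%N -> M <= a i) ->
    `| marginal d d' m a kp / tsallis_approx d' m a kp - 1 | < eps.
Proof.
move=> eps eps0.
have d'd : (d' <= d)%N by rewrite (leq_trans hd'2)// leq_subr.
pose n := (d - d')%N.
have d'n : (d' + n)%N = d by rewrite subnKC.
(* Total number of relative errors: [n] from the marginal sum and [d] from the normalizing
   constant. *)
pose N := (n + d)%N.
have N1 : 1 <= N%:R :> R by rewrite ler1n /N addn_gt0 (leq_trans _ hd) ?orbT.
(* With [N * eta = mn], the bound 1/2 permits [expr_bounds_near1], and [eps / 4] makes the final
   error [2 N eta] at most [eps / 2]. *)
pose mn := Num.min (2^-1) (eps / 4) : R.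
have mn0 : 0 < mn by rewrite lt_min invr_gt0 ltr0n divr_gt0.
have mn1 : mn <= 2^-1 by rewrite ge_min lexx.
have mn2 : mn <= eps / 4 by rewrite ge_min lexx orbT.
pose eta := mn / N%:R.
have N0 : 0 < N%:R :> R by rewrite (lt_le_trans _ N1).
have eta0 : 0 < eta by rewrite divr_gt0.
have Neta : N%:R * eta = mn by rewrite mulrC divfK// gt_eqF.
have eta1 : eta < 1 by have := ler_wpM2r (ltW eta0) N1; rewrite Neta; lra.
pose c (i : nat) : R := student_const ((m + i.+1%:R) / 2).
have c0 i : 0 < c i by apply: student_const_gt0; exact: half_lt_exponent.
have ec0 i : 0 < eta * c i by exact: mulr_gt0.
(* The sum dominates every single threshold [(eta * c i)^-1]; the added 1 makes the inequality
   strict. *)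
exists (\sum_(i < d) (eta * c i)^-1 + 1) => a aM.
have ac i : (i < d)%N -> (eta * c i)^-1 < a i.
  move=> id; apply: lt_le_trans (aM i id); rewrite (bigD1 (Ordinal id))//= -addrA.
  rewrite ltrDl ltr_wpDl// sumr_ge0// => j _.
  by rewrite invr_ge0 ltW.
have a0 i : (i < d)%N -> 0 < a i.
  by move=> /ac; apply: lt_trans; rewrite invr_gt0.
have aeta i : (i < d)%N -> 1 <= eta * (a i * c i).
  move=> /ac; rewrite -[X in X < _]mul1r ltr_pdivrMr// => /ltW.
  by rewrite mulrCA.
(* [kp] is extended by 0 to a prefix indexed by [nat], as [lattice_fiber] expects. *)
pose kpn (i : nat) : int := if insub i is Some j then kp j else 0.
have kpnE (j : 'I_d') : kpn j = kp j by rewrite /kpn valK.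
pose q := 1 - eta.
have q0 : 0 < q by rewrite subr_gt0.
have eta01 : 0 < eta < 1 by rewrite eta0.
have bounds := @lattice_fiber_sum_bounds R d m eta a hm eta01 a0 aeta.
(* Up to the relative errors, the normalizing constant is [Y], the marginal is [Z * b] divided by
   it, and [Y = A * Z]. *)
pose Y := \prod_(0 <= i < d) (a i * c i).
pose A := \prod_(0 <= i < d') (a i * c i).
pose Z := \prod_(d' <= i < d) (a i * c i).
have YE : Y = A * Z by rewrite /Y (big_cat_nat (n := d')).
have A0 : 0 < A.
  rewrite /A big_mkord; apply: prodr_gt0 => i _.
  by rewrite mulr_gt0// a0// (leq_trans (ltn_ord i)).
have Z0 : 0 < Z.
  rewrite /Z big_nat_cond; apply: prodr_gt0 => i /andP[/andP[_ id] _].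
  by rewrite mulr_gt0// a0.
pose b := prefix_form a d' kpn `^ (- ((m + d'%:R) / 2)).
have b0 : 0 < b by rewrite powR_gt0// (lt_le_trans _ (prefix_form_ge1 _ _ _)).
(* No coordinate is fixed here: the form reduces to 1 and only the product [Y] remains. *)
have [F FE] : exists2 F, f_md d m a = F & q ^+ d * Y <= F <= q ^- d * Y.
  have [F FE FB] := bounds d 0%N kpn 1 (add0n d) ler01; exists F; last first.
    move: FB; rewrite /prefix_form big_ord0 addr0 powR1 /=.
    by rewrite mulr1 mul1r.
  rewrite /f_md (_ : [set: _] = lattice_fiber d 0 kpn); last first.
    by apply/seteqP; split.
  rewrite -[RHS]/(fine F%:E) -FE; congr fine.
  by apply: eq_esum => k _; rewrite mul1r.
rewrite -/q => /andP[F1 F2].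
have F0 : 0 < F by apply: lt_le_trans F1; rewrite mulr_gt0 ?exprn_gt0 ?YE ?mulr_gt0.
have FV0 : 0 <= F^-1 by rewrite invr_ge0 ltW.
(* The same bounds with [C = F^-1] and [n] free coordinates. *)
have [T TE] : exists2 T, marginal d d' m a kp = T &
    q ^+ n * (F^-1 * Z * b) <= T <= q ^- n * (F^-1 * Z * b).
  have [T TE TB] := bounds n d' kpn F^-1 d'n FV0.
  exists T => //.
  rewrite /marginal (_ : [set _ | _] = lattice_fiber d d' kpn); last first.
    apply/seteqP; split=> k /= kk.
      by move=> i id'; rewrite (kk i (Ordinal id'))// -kpnE.
    by move=> i j ij; rewrite kk -?kpnE ij.
  rewrite -[RHS]/(fine T%:E) -TE; congr fine.
  by apply: eq_esum => k _; rewrite /tsallis_p FE mulrC.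
move=> /andP[T1 T2].
have -> : tsallis_approx d' m a kp = A^-1 * b.
  rewrite /tsallis_approx /A big_mkord big_split/= prod_student_const//.
  have -> : b = (1 + \sum_(j < d') ((kp j)%:~R ^+ 2 / (a (val j)) ^+ 2))
      `^ (- ((m + d'%:R) / 2)).
    by rewrite /b /prefix_form; under eq_bigr do rewrite kpnE.
  congr (_ * _); rewrite mulrC !invfM !invrK; ring.
rewrite TE; apply: (@le_lt_trans _ _ (2 * (N%:R * eta))); last by rewrite Neta; lra.
apply: expr_bounds_near1; first by rewrite ltW.
  by rewrite Neta.
rewrite -/q.
(* The ratio splits into the relative errors of the marginal sum and of the normalizing constant,
   bounded by powers [n] and [d] of [q], hence together by power [N]. *)
have rho : T / (A^-1 * b) = (T / (F^-1 * Z * b)) * (Y / F).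
  by rewrite YE; field; rewrite !gt_eqF.
have V0 : 0 < F^-1 * Z * b by rewrite !mulr_gt0 ?invr_gt0.
have Y0 : 0 < Y by rewrite YE mulr_gt0.
have t1 : q ^+ n <= T / (F^-1 * Z * b) by rewrite ler_pdivlMr.
have t2 : T / (F^-1 * Z * b) <= q ^- n by rewrite ler_pdivrMr.
have u1 : q ^+ d <= Y / F.
  by rewrite ler_pdivlMr// mulrC -ler_pdivlMr ?exprn_gt0// mulrC.
have u2 : Y / F <= q ^- d.
  by rewrite ler_pdivrMr// -ler_pdivrMl ?invr_gt0 ?exprn_gt0// invrK.
rewrite rho /N exprD [X in _ <= _ <= X]invfM.
by apply/andP; split; apply: ler_pM => //; rewrite ?exprn_ge0 ?(ltW q0)//
  ?(le_trans _ t1) ?divr_ge0 ?exprn_ge0 ?(ltW q0) ?(ltW Y0) ?(ltW F0).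
Qed.
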